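(* Let $2\le K<\infty$, $2\le d<\infty$, and let $\boldsymbol{A}=\{A_1,\dotsc,A_K\}\subset\mathbb{R}^{d\times d}$. Suppose that for some integer $n^*\ge 1$ there exists an $(\boldsymbol{A},n^* )$-optimal word $w^*$ such that $\boldsymbol{A}(w^* )^T\boldsymbol{A}(w^* )\in\boldsymbol{A}^{2n^*}$ (resp. $\boldsymbol{A}(w^* )\boldsymbol{A}(w^* )^T\in\boldsymbol{A}^{2n^*}$). Then $\boldsymbol{A}$ has the spectral finiteness, and $$\boldsymbol{\rho}(\boldsymbol{A})=\|\boldsymbol{A}(w^* )\|^{1/n^*}=\rho\left(\boldsymbol{A}(w^* )^T\boldsymbol{A}(w^* )\right)^{1/(2n^* )}\quad\left(\text{resp. }\boldsymbol{\rho}(\boldsymbol{A})=\|\boldsymbol{A}(w^* )\|^{1/n^*}=\rho\left(\boldsymbol{A}(w^* )\boldsymbol{A}(w^* )^T\right)^{1/(2n^* )}\right).$$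
   Context: For a real square matrix $M$, $\rho(M)$ is its usual spectral radius and $M^T$ its transpose. $\|\cdot\|$ denotes the matrix norm on $\mathbb{R}^{d\times d}$ induced by the Euclidean vector norm (the spectral norm, so $\|M\|^2=\rho(M^TM)$). For a finite set $\boldsymbol{A}=\{A_1,\dotsc,A_K\}\subset\mathbb{R}^{d\times d}$ and $n\ge1$, let $\boldsymbol{A}^n=\{M_1\cdots M_n : M_i\in\boldsymbol{A},\ 1\le i\le n\}$. The generalized spectral radius of $\boldsymbol{A}$ is $$\boldsymbol{\rho}(\boldsymbol{A})=\sup_{n\ge1}\max_{M\in\boldsymbol{A}^n}\rho(M)^{1/n}.$$ $\boldsymbol{A}$ has the spectral finiteness if there exist $n\ge1$ and $M\in\boldsymbol{A}^{n}$ with $\boldsymbol{\rho}(\boldsymbol{A})=\rho(M)^{1/n}$. Let $\boldsymbol{K}=\{1,\dotsc,K\}$. For a word $w=(k_1,\dotsc,k_n)\in\boldsymbol{K}^n$ of length $n$, write $\boldsymbol{A}(w)=A_{k_1}\cdots A_{k_n}$. A word $w^*\in\boldsymbol{K}^n$ is an $(\boldsymbol{A},n)$-optimal word if $\|\boldsymbol{A}(w^* )\|=\max_{w\in\boldsymbol{K}^n}\|\boldsymbol{A}(w)\|$. *)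

(* Defs.v *)
From HB Require Import structures.
From mathcomp Require Export all_boot all_order all_algebra.
From mathcomp Require Export all_classical all_reals all_analysis.
From mathcomp Require Export complex.

Set Implicit Arguments.
Unset Strict Implicit.
Unset Printing Implicit Defensive.

Import Order.TTheory GRing.Theory Num.Theory.

Local Open Scope classical_set_scope.
Local Open Scope ring_scope.

(* In R[i] the norm `|z| is itself an element of R[i]; its real part is the
   modulus of z as an element of R. *)
Definition spectral_radius (R : realType) (d : nat) (M : 'M[R]_d) : R :=
  sup [set complex.Re `|z| | z in
    [set z : R[i] | eigenvalue (map_mx (real_complex R) M) z]].

(* The library norm `|x| on matrices is the max norm, hence this definition. *)
Definition enorm (R : realType) (d : nat) (x : 'cV[R]_d) : R :=
  Num.sqrt (\sum_(i < d) x i 0 ^+ 2).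

Definition opnorm (R : realType) (d : nat) (M : 'M[R]_d) : R :=
  sup [set enorm (M *m x) | x in [set x : 'cV[R]_d | enorm x = 1]].

Definition set_products (R : realType) (d : nat) (S : set 'M[R]_d) (n : nat) :
    set 'M[R]_d :=
  [set \prod_(M <- s) M |
    s in [set s : n.-tuple 'M[R]_d | forall i, S (tnth s i)]].

(* For finite nonempty S the inner sup ranges over a finite nonempty set, so it
   is a maximum, and the outer one over a bounded set; [sup] is a meaningless
   default otherwise. *)
Definition gen_spectral_radius (R : realType) (d : nat) (S : set 'M[R]_d) : R :=
  sup [set sup [set spectral_radius M `^ n%:R^-1 | M in set_products S n] |
    n in [set n : nat | (1 <= n)%N]].

Definition spectral_finiteness (R : realType) (d : nat) (S : set 'M[R]_d) :
    Prop :=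
  exists n : nat, (1 <= n)%N /\
    exists M : 'M[R]_d, set_products S n M /\
      gen_spectral_radius S = spectral_radius M `^ n%:R^-1.

Definition word_prod (R : realType) (d K : nat) (A : 'I_K -> 'M[R]_d) (n : nat)
    (w : n.-tuple 'I_K) : 'M[R]_d :=
  \prod_(k <- w) A k.

Definition optimal_word (R : realType) (d K : nat) (A : 'I_K -> 'M[R]_d)
    (n : nat) (w : n.-tuple 'I_K) : Prop :=
  forall v : n.-tuple 'I_K, opnorm (word_prod A v) <= opnorm (word_prod A w).

(* Main.v *)
(* Write c for the norm of the optimal product of length n. If M is a product
   of length m, then M^n splits into m products of length n, so
   rho(M)^n <= |M^n| <= c^m, i.e. rho(M)^(1/m) <= c^(1/n). The Gram matrix of the
   optimal product has length 2n and spectral radius c^2, so it attains this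
   bound.

   That c^2 is an eigenvalue of N = M^T M is shown without compactness: since
   |N x|^2 <= c^2 |M x|^2, one has |(N - c^2) x|^2 <= c^2 (c^2 - |M x|^2) for
   every unit vector x, so invertibility of N - c^2 would keep |M x| uniformly
   below c. *)
Require Import Defs.
From mathcomp Require Import all_boot all_order all_algebra.
From mathcomp Require Import all_classical all_reals all_analysis.
From mathcomp Require Import ring lra.

Set Implicit Arguments.
Unset Strict Implicit.
Unset Printing Implicit Defensive.

Import Order.TTheory GRing.Theory Num.Theory.
Local Open Scope classical_set_scope.
Local Open Scope ring_scope.

(** * Euclidean inner product and norm *)

Definition dotv {R : realType} {d : nat} (x y : 'cV[R]_d) : R :=
  (x^T *m y) 0 0.

Lemma dotvE (R : realType) d (x y : 'cV[R]_d) :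
  dotv x y = \sum_i x i 0 * y i 0.
Proof. by rewrite /dotv mxE; apply: eq_bigr => i _; rewrite mxE. Qed.

Lemma dotvC (R : realType) d (x y : 'cV[R]_d) : dotv x y = dotv y x.
Proof. by rewrite !dotvE; apply: eq_bigr => i _; rewrite mulrC. Qed.

Lemma dotvBr (R : realType) d (x y z : 'cV[R]_d) :
  dotv x (y - z) = dotv x y - dotv x z.
Proof. by rewrite /dotv mulmxBr !mxE. Qed.

Lemma dotvZr (R : realType) d a (x y : 'cV[R]_d) :
  dotv x (a *: y) = a * dotv x y.
Proof. by rewrite /dotv -scalemxAr mxE. Qed.

Lemma dotvBl (R : realType) d (x y z : 'cV[R]_d) :
  dotv (y - z) x = dotv y x - dotv z x.
Proof. by rewrite dotvC dotvBr !(dotvC _ x). Qed.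

Lemma dotvZl (R : realType) d a (x y : 'cV[R]_d) :
  dotv (a *: x) y = a * dotv x y.
Proof. by rewrite dotvC dotvZr dotvC. Qed.

Lemma dotv_trmx (R : realType) d (M : 'M[R]_d) (x y : 'cV[R]_d) :
  dotv (M *m x) y = dotv x (M^T *m y).
Proof. by rewrite /dotv trmx_mul mulmxA. Qed.

Lemma dotvv_ge0 (R : realType) d (x : 'cV[R]_d) : 0 <= dotv x x.
Proof. by rewrite dotvE sumr_ge0 // => i _; rewrite -expr2 sqr_ge0. Qed.

Lemma dotvv_eq0 (R : realType) d (x : 'cV[R]_d) : dotv x x = 0 -> x = 0.
Proof.
rewrite dotvE => /eqP; rewrite psumr_eq0; last first.
  by move=> i _; rewrite -expr2 sqr_ge0.
move=> /allP x0; apply/colP => i; rewrite mxE; apply/eqP.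
by have := x0 i; rewrite mem_index_enum mulf_eq0 orbb; apply.
Qed.

Lemma CauchySchwarz_dotv (R : realType) d (x y : 'cV[R]_d) :
  dotv x y ^+ 2 <= dotv x x * dotv y y.
Proof.
have [x0|xn0] := eqVneq (dotv x x) 0.
  by rewrite (dotvv_eq0 x0) /dotv linear0 !mul0mx !mxE mul0r expr0n.
have x_gt0 : 0 < dotv x x by rewrite lt_def xn0 dotvv_ge0.
have := dotvv_ge0 (dotv x x *: y - dotv x y *: x).
rewrite !(dotvBl, dotvBr, dotvZl, dotvZr) (dotvC y x).
rewrite (_ : _ - _ = dotv x x * (dotv x x * dotv y y - dotv x y ^+ 2)); last first.
  by ring.
by rewrite pmulr_rge0 // subr_ge0.
Qed.

Lemma enormE (R : realType) d (x : 'cV[R]_d) : enorm x = Num.sqrt (dotv x x).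
Proof. by rewrite /enorm dotvE; under eq_bigr do rewrite expr2. Qed.

Lemma enorm_ge0 (R : realType) d (x : 'cV[R]_d) : 0 <= enorm x.
Proof. exact: sqrtr_ge0. Qed.

Lemma sqr_enorm (R : realType) d (x : 'cV[R]_d) : enorm x ^+ 2 = dotv x x.
Proof. by rewrite enormE sqr_sqrtr ?dotvv_ge0. Qed.

Lemma enormZ (R : realType) d a (x : 'cV[R]_d) :
  enorm (a *: x) = `|a| * enorm x.
Proof.
by rewrite !enormE dotvZl dotvZr mulrA -expr2 sqrtrM ?sqr_ge0 // sqrtr_sqr.
Qed.

Lemma enorm_eq0 (R : realType) d (x : 'cV[R]_d) : (enorm x == 0) = (x == 0).
Proof.
apply/eqP/eqP => [x0|->]; last by rewrite enormE /dotv mulmx0 mxE sqrtr0.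
by apply: dotvv_eq0; rewrite -sqr_enorm x0 expr0n.
Qed.

(** Cauchy-Schwarz on each row. The bound is crude, but it shows that the supremum defining [opnorm]
    is over a bounded set. *)
Lemma enorm_mulmx_frobenius (R : realType) d (M : 'M[R]_d) (x : 'cV[R]_d) :
  enorm (M *m x) <= Num.sqrt (\sum_i \sum_j M i j ^+ 2) * enorm x.
Proof.
have M0 i : 0 <= \sum_j M i j ^+ 2 by apply: sumr_ge0 => j _; exact: sqr_ge0.
rewrite !enormE -sqrtrM ?sumr_ge0// ler_wsqrtr// mulr_suml dotvE.
apply: ler_sum => i _; rewrite -expr2.
have := CauchySchwarz_dotv (row i M)^T x.
rewrite {1}/dotv trmxK -row_mul mxE => /le_trans; apply.
rewrite ler_wpM2r ?dotvv_ge0 // dotvE le_eqVlt; apply/orP; left; apply/eqP.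
by apply: eq_bigr => j _; rewrite !mxE -expr2.
Qed.

(** * Suprema of nonnegative sets and the operator norm *)

Lemma nonneg_sup_ge0 (R : realType) (E : set R) :
  (forall x, E x -> 0 <= x) -> 0 <= sup E.
Proof.
move=> E0; have [[[x Ex] ubE]|] := pselect (has_sup E); last first.
  by move/sup_out => ->.
exact: le_trans (E0 _ Ex) (ub_le_sup ubE Ex).
Qed.

(** Assuming [0 <= b] covers the empty set, whose [sup] is 0, so later upper bounds need no
    nonemptiness argument. *)
Lemma nonneg_sup_le (R : realType) (E : set R) b :
  0 <= b -> ubound E b -> sup E <= b.
Proof.
move=> b0 Eb; have [->|/set0P E0] := eqVneq E set0; first by rewrite sup0.
exact: ge_sup.
Qed.

Lemma has_ubound_opnorm (R : realType) d (M : 'M[R]_d) :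
  has_ubound [set enorm (M *m x) | x in [set x : 'cV[R]_d | enorm x = 1]].
Proof.
eexists => _ [x /= x1 <-].
by rewrite (le_trans (enorm_mulmx_frobenius _ _)) // x1 mulr1.
Qed.

Lemma opnorm_ge0 (R : realType) d (M : 'M[R]_d) : 0 <= opnorm M.
Proof. by apply: nonneg_sup_ge0 => _ [x _ <-]; exact: enorm_ge0. Qed.

Lemma enorm_mulmx_le (R : realType) d (M : 'M[R]_d) (x : 'cV[R]_d) :
  enorm (M *m x) <= opnorm M * enorm x.
Proof.
have [->|x0] := eqVneq x 0.
  by rewrite mulmx0 !enormE /dotv mulmx0 mxE sqrtr0 mulr0.
have nx0 : 0 < enorm x by rewrite lt_def enorm_eq0 x0 enorm_ge0.
rewrite -ler_pdivrMr // mulrC.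
have -> : (enorm x)^-1 * enorm (M *m x) = enorm (M *m ((enorm x)^-1 *: x)).
  by rewrite -scalemxAr enormZ ger0_norm // invr_ge0 ltW.
apply: (ub_le_sup (has_ubound_opnorm M)); eexists; last by reflexivity.
by rewrite /= enormZ ger0_norm ?invr_ge0 ?enorm_ge0 // mulVf ?gt_eqF.
Qed.

Lemma exists_unit_vector (R : realType) d (hd : (0 < d)%N) :
  exists x : 'cV[R]_d, enorm x = 1.
Proof.
exists (delta_mx (Ordinal hd) 0); rewrite enormE /dotv trmx_delta mul_delta_mx.
by rewrite mxE !eqxx sqrtr1.
Qed.

Lemma opnorm_le (R : realType) d (M : 'M[R]_d) b : 0 <= b ->
  (forall x : 'cV[R]_d, enorm x = 1 -> enorm (M *m x) <= b) -> opnorm M <= b.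
Proof.
by move=> b0 Mb; apply: nonneg_sup_le => // _ [x /= x1 <-]; exact: Mb.
Qed.

Lemma opnormM (R : realType) d (M N : 'M[R]_d) :
  opnorm (M *m N) <= opnorm M * opnorm N.
Proof.
apply: opnorm_le => [|x x1]; first by rewrite mulr_ge0 ?opnorm_ge0.
rewrite -mulmxA (le_trans (enorm_mulmx_le _ _)) //.
rewrite ler_wpM2l ?opnorm_ge0 //.
by rewrite (le_trans (enorm_mulmx_le _ _)) // x1 mulr1.
Qed.

(** Equality fails for [d = 0]: there are no unit vectors, and the norm is the [sup] of the empty
    set. *)
Lemma opnorm1_le (R : realType) d : opnorm (1%:M : 'M[R]_d) <= 1.
Proof. by apply: opnorm_le => // x x1; rewrite mul1mx x1. Qed.

Lemma opnorm_trmx_le (R : realType) d (M : 'M[R]_d) : opnorm M^T <= opnorm M.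
Proof.
apply: opnorm_le => [|x x1]; first exact: opnorm_ge0.
have [->|n0] := eqVneq (enorm (M^T *m x)) 0; first exact: opnorm_ge0.
have y0 : 0 < enorm (M^T *m x) by rewrite lt_def n0 enorm_ge0.
(* After multiplication by |M^T x|, the left side is the inner product of M M^T x with x, at most |M
   M^T x| by Cauchy-Schwarz. *)
rewrite -(ler_pM2r y0) -expr2 sqr_enorm -dotv_trmx.
apply: (le_trans _ (enorm_mulmx_le _ _)).
rewrite (le_trans (ler_norm _)) // -sqrtr_sqr.
rewrite -[leRHS]mulr1 -[in leRHS]x1 !enormE -sqrtrM ?dotvv_ge0 //.
by rewrite ler_wsqrtr // CauchySchwarz_dotv.
Qed.

Lemma opnorm_trmx (R : realType) d (M : 'M[R]_d) : opnorm M^T = opnorm M.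
Proof.
apply/eqP; rewrite eq_le opnorm_trmx_le /=.
by rewrite -{1}(trmxK M) opnorm_trmx_le.
Qed.


Lemma eigenvalue_gram_opnorm (R : realType) d (M : 'M[R]_d) :
  (0 < d)%N -> eigenvalue (M^T *m M) (opnorm M ^+ 2).
Proof.
(* Here [c] is the square of the norm. If it is not an eigenvalue, [Q], which is M^T M - c, has
   trivial kernel and is invertible. *)
move=> d_gt0; set c := opnorm M ^+ 2; apply: contraT.
rewrite negbK /eigenspace kermx_eq0 row_free_unit.
set Q := (X in X \in _) => Qu.
have c0 : 0 <= c by exact: sqr_ge0.
have QM (x : 'cV[R]_d) : enorm x = 1 ->
    enorm (Q *m x) ^+ 2 <= c * (c - enorm (M *m x) ^+ 2).
  move=> x1; have xx : dotv x x = 1 by rewrite -sqr_enorm x1 expr1n.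
  have Nx_x : dotv ((M^T *m M) *m x) x = enorm (M *m x) ^+ 2.
    by rewrite sqr_enorm dotvC -mulmxA -dotv_trmx.
  have Nx_Nx : enorm ((M^T *m M) *m x) ^+ 2 <= c * enorm (M *m x) ^+ 2.
    rewrite -mulmxA /c -exprMn lerXn2r ?nnegrE ?mulr_ge0 ?enorm_ge0 ?opnorm_ge0//.
    by rewrite (le_trans (enorm_mulmx_le _ _)) // opnorm_trmx.
  rewrite sqr_enorm /Q mulmxBl mul_scalar_mx !(dotvBl, dotvBr, dotvZl, dotvZr).
  by rewrite xx (dotvC x) Nx_x -sqr_enorm; lra.
set B := opnorm (invmx Q) ^+ 2.
(* From x = Q^-1 (Q x) one gets 1 <= B |Q x|^2, to which [QM] applies. *)
have gap (x : 'cV[R]_d) : enorm x = 1 ->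
    1 <= B * c * (c - enorm (M *m x) ^+ 2).
  move=> x1; rewrite -mulrA (@le_trans _ _ (B * enorm (Q *m x) ^+ 2)) //; last first.
    by rewrite ler_wpM2l ?sqr_ge0 ?QM.
  rewrite -exprMn expr_ge1 ?mulr_ge0 ?enorm_ge0 ?opnorm_ge0 //.
  by rewrite -x1 -{1}(mulKmx Qu x) enorm_mulmx_le.
have [u u1] := exists_unit_vector R d_gt0.
have Bc0 : 0 < B * c.
  rewrite lt_def mulr_ge0 ?sqr_ge0 // andbT; apply/eqP => Bc0.
  by have := gap u u1; rewrite Bc0 mul0r ler10.
have Me (x : 'cV[R]_d) : enorm x = 1 -> enorm (M *m x) ^+ 2 <= c - (B * c)^-1.
  by move=> /gap; rewrite -ler_pdivrMl // mulr1 => ?; lra.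
have : opnorm M <= Num.sqrt (c - (B * c)^-1).
  apply: opnorm_le => [|x x1]; first exact: sqrtr_ge0.
  by rewrite -(ger0_norm (enorm_ge0 _)) -sqrtr_sqr ler_wsqrtr ?Me.
(* Since [Num.sqrt] vanishes on negative numbers, comparing the radicands requires this one to be
   nonnegative; the unit vector [u] shows it. *)
have e0 := le_trans (sqr_ge0 _) (Me _ u1).
rewrite -[X in X <= _](ger0_norm (opnorm_ge0 M)) -sqrtr_sqr ler_sqrt // -/c.
by have : 0 < (B * c)^-1; [rewrite invr_gt0|lra].
Qed.

(** * Complex eigenvalues and the spectral radius *)

Lemma normc_Re (R : realType) (z : R[i]) :
  `|z| = real_complex R (complex.Re `|z|).
Proof. by rewrite normc_def. Qed.

Lemma Re_normcX (R : realType) (z : R[i]) k :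
  complex.Re `|z ^+ k| = complex.Re `|z| ^+ k.
Proof. by rewrite normrX {1}normc_Re -rmorphXn. Qed.

Lemma Re_normc_ge0 (R : realType) (z : R[i]) : 0 <= complex.Re `|z|.
Proof. by rewrite normc_def sqrtr_ge0. Qed.

Lemma sqr_Re_normc (R : realType) (z : R[i]) :
  complex.Re `|z| ^+ 2 = complex.Re z ^+ 2 + complex.Im z ^+ 2.
Proof. by rewrite normc_def sqr_sqrtr // addr_ge0 ?sqr_ge0. Qed.

(* For a complex row v = a + ib, the real and imaginary parts of v M are a M and
   b M, so |v M|^2 = |a M|^2 + |b M|^2. *)
Lemma eigenvalue_le_opnorm (R : realType) d (M : 'M[R]_d) (z : R[i]) :
  eigenvalue (map_mx (real_complex R) M) z -> complex.Re `|z| <= opnorm M.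
Proof.
case/eigenvalueP => v vM v0.
(* Eigenvectors are rows whereas [dotv] takes columns, so M^T acts on the transposed parts;
   [opnorm_trmx] absorbs the transposition. *)
pose a := (map_mx (@complex.Re R) v)^T; pose b := (map_mx (@complex.Im R) v)^T.
have aM i : (M^T *m a) i 0 = complex.Re (z * v 0 i).
  rewrite -trmx_mul mxE.
  have := congr1 (fun u : 'rV_d => complex.Re (u 0 i)) vM.
  rewrite !mxE => <-; rewrite raddf_sum; apply: eq_bigr => j _; rewrite !mxE.
  by case: (v 0 j) => p q /=; ring.
have bM i : (M^T *m b) i 0 = complex.Im (z * v 0 i).
  rewrite -trmx_mul mxE.
  have := congr1 (fun u : 'rV_d => complex.Im (u 0 i)) vM.
  rewrite !mxE => <-; rewrite raddf_sum; apply: eq_bigr => j _; rewrite !mxE.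
  by case: (v 0 j) => p q /=; ring.
have zM : complex.Re `|z| ^+ 2 * (dotv a a + dotv b b) =
    dotv (M^T *m a) (M^T *m a) + dotv (M^T *m b) (M^T *m b).
  rewrite !dotvE -!big_split mulr_sumr /=; apply: eq_bigr => i _.
  rewrite aM bM !mxE sqr_Re_normc.
  by case: (v 0 i) => p q; case: z {vM aM bM} => r s /=; ring.
(* A nonzero complex vector has a nonzero real or imaginary part, so this factor can be cancelled
   from [zM]. *)
have ab0 : 0 < dotv a a + dotv b b.
  rewrite lt_def addr_ge0 ?dotvv_ge0 // andbT; apply: contra v0.
  rewrite paddr_eq0 ?dotvv_ge0 // => /andP[/eqP/dotvv_eq0 a0 /eqP/dotvv_eq0 b0].
  apply/eqP/rowP => i; rewrite mxE.
  have := congr1 (fun u : 'cV_d => u i 0) a0.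
  have := congr1 (fun u : 'cV_d => u i 0) b0.
  by rewrite !mxE; case: (v 0 i) => p q /= -> ->.
have ubM (x : 'cV[R]_d) :
    dotv (M^T *m x) (M^T *m x) <= opnorm M ^+ 2 * dotv x x.
  rewrite -!sqr_enorm -exprMn lerXn2r ?nnegrE ?mulr_ge0 ?enorm_ge0 ?opnorm_ge0//.
  by rewrite -opnorm_trmx enorm_mulmx_le.
rewrite -(@ler_pXn2r _ 2) ?nnegrE ?Re_normc_ge0 ?opnorm_ge0 //.
by rewrite -(ler_pM2r ab0) zM mulrDr lerD ?ubM.
Qed.

Lemma eigenvalueX (R : realType) d (M : 'M[R]_d) (z : R[i]) k :
  eigenvalue (map_mx (real_complex R) M) z ->
  eigenvalue (map_mx (real_complex R) (M ^+ k)) (z ^+ k).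
Proof.
case/eigenvalueP => v vM v0; apply/eigenvalueP; exists v => //.
elim: k => [|k IH]; first by rewrite expr0 map_mx1 mulmx1 scale1r.
by rewrite exprSr map_mxM mulmxA IH -scalemxAl vM scalerA -exprSr.
Qed.

Lemma spectral_radius_ge0 (R : realType) d (M : 'M[R]_d) : 0 <= spectral_radius M.
Proof. by apply: nonneg_sup_ge0 => _ [z _ <-]; exact: Re_normc_ge0. Qed.

(** The operator norm bounds all eigenvalues, so the [sup] is a genuine upper bound. *)
Lemma eigenvalue_le_spectral_radius (R : realType) d (M : 'M[R]_d) (z : R[i]) :
  eigenvalue (map_mx (real_complex R) M) z ->
  complex.Re `|z| <= spectral_radius M.
Proof.
move=> Mz; apply: ub_le_sup; last by exists z.
by exists (opnorm M) => _ [y /= My <-]; exact: eigenvalue_le_opnorm.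
Qed.

Lemma spectral_radius_gram (R : realType) d (M : 'M[R]_d) : (0 < d)%N ->
  spectral_radius (M^T *m M) = opnorm M ^+ 2.
Proof.
move=> d_gt0; apply/eqP; rewrite eq_le; apply/andP; split.
  apply: nonneg_sup_le; first exact: sqr_ge0.
  move=> _ [z /= /eigenvalue_le_opnorm /le_trans + <-]; apply.
  by rewrite (le_trans (opnormM _ _)) // opnorm_trmx expr2.
(* The real eigenvalue becomes a complex one as a root of the characteristic polynomial, which
   commutes with the embedding. *)
have := eigenvalue_gram_opnorm M d_gt0; rewrite eigenvalue_root_char.
rewrite -(fmorph_root (real_complex R)) map_char_poly -eigenvalue_root_char.
move=> /eigenvalue_le_spectral_radius; rewrite normc_def /=.
by rewrite expr0n addr0 sqrtr_sqr ger0_norm ?sqr_ge0.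
Qed.

(** * Products along words and the finiteness property *)

Lemma opnorm_prod_optimal (R : realType) (K d : nat) (A : 'I_K -> 'M[R]_d)
    n (w : n.-tuple 'I_K) m (s : seq 'I_K) :
  optimal_word A w -> size s = (m * n)%N ->
  opnorm (\prod_(k <- s) A k) <= opnorm (word_prod A w) ^+ m.
Proof.
move=> wP; elim: m s => [|m IH] s ss.
  by rewrite (size0nil ss) big_nil expr0 opnorm1_le.
rewrite -(cat_take_drop n s) big_cat exprS (le_trans (opnormM _ _)) //.
rewrite ler_pM ?opnorm_ge0 //; last first.
  by apply: IH; rewrite size_drop ss mulSn addKn.
have sn : size (take n s) == n by rewrite size_takel // ss mulSn leq_addr.
exact: wP (Tuple sn).
Qed.

(** Choosing an index for each factor gives a word, kept as a plain sequence so that it can be cut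
    and concatenated. *)
Lemma set_products_range (R : realType) (K d : nat) (A : 'I_K -> 'M[R]_d) m M :
  set_products (range A) m M ->
  exists2 s : seq 'I_K, size s = m & M = \prod_(k <- s) A k.
Proof.
case=> t tA <-.
suff [s st ->] : exists2 s : seq 'I_K, size s = size t &
    \prod_(N <- t) N = \prod_(k <- s) A k by exists s; rewrite ?st ?size_tuple.
have : forall N, N \in tval t -> range A N by move=> N /tnthP[i ->].
elim: (tval t) => [|N r IH] rA; first by exists [::]; rewrite // !big_nil.
have [k _ kN] := rA N (mem_head _ _).
have [|s sr rs] := IH; first by move=> L Lr; apply: rA; rewrite in_cons Lr orbT.
by exists (k :: s); rewrite /= ?sr // !big_cons rs kN.
Qed.

Lemma prod_seqX (R : realType) (K d : nat) (A : 'I_K -> 'M[R]_d) s n :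
  exists2 r : seq 'I_K, size r = (n * size s)%N &
    (\prod_(k <- s) A k) ^+ n = \prod_(k <- r) A k.
Proof.
elim: n => [|n [r rn IH]]; first by exists [::]; rewrite // big_nil expr0.
by exists (s ++ r); rewrite ?size_cat ?rn ?mulSn // exprS IH big_cat.
Qed.

Lemma spectral_radius_root_le (R : realType) (K d : nat) (A : 'I_K -> 'M[R]_d)
    n (w : n.-tuple 'I_K) m M : (0 < n)%N -> (0 < m)%N -> optimal_word A w ->
  set_products (range A) m M ->
  spectral_radius M `^ m%:R^-1 <= opnorm (word_prod A w) `^ n%:R^-1.
Proof.
move=> n0 m0 wP /set_products_range [s sm ->].
set c := opnorm _; have c0 : 0 <= c by exact: opnorm_ge0.
have cE : (c `^ n%:R^-1) ^+ m = c `^ (m%:R / n%:R).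
  by rewrite -powR_mulrn ?powR_ge0 // -powRrM mulrC.
have rE x : 0 <= x -> (x `^ (n%:R^-1)) ^+ n = x.
  move=> x0; rewrite -powR_mulrn ?powR_ge0 // -powRrM.
  by rewrite mulVf ?pnatr_eq0 ?gtn_eqF // powRr1.
have root_le : spectral_radius (\prod_(k <- s) A k) <= (c `^ n%:R^-1) ^+ m.
  apply: nonneg_sup_le; first by rewrite exprn_ge0 ?powR_ge0.
  (* The power z^n is an eigenvalue of M^n, a product of n * m letters that is then read as m blocks
     of length n. *)
  move=> _ [z /= /(eigenvalueX n) /eigenvalue_le_opnorm + <-].
  have [r rn ->] := prod_seqX A s n; rewrite Re_normcX => zn.
  rewrite -(@ler_pXn2r _ n) ?nnegrE ?Re_normc_ge0 ?exprn_ge0 ?powR_ge0 //.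
  rewrite (le_trans zn) // exprAC rE //; apply: opnorm_prod_optimal => //.
  by rewrite rn sm mulnC.
(* Writing the bound as an m-th root reduces the claim to monotonicity of that root. *)
have -> : c `^ n%:R^-1 = ((c `^ n%:R^-1) ^+ m) `^ m%:R^-1.
  rewrite -powR_mulrn ?powR_ge0 // -powRrM.
  by rewrite mulfV ?pnatr_eq0 ?gtn_eqF // powRr1 ?powR_ge0.
by rewrite ge0_ler_powR ?invr_ge0 ?ler0n ?nnegrE ?spectral_radius_ge0 //
  exprn_ge0 ?powR_ge0.
Qed.

(* N is the optimal product or its transpose. *)
Lemma gram_spectral_finiteness (R : realType) (K d : nat) (A : 'I_K -> 'M[R]_d)
    n (w : n.-tuple 'I_K) (N : 'M[R]_d) : (0 < d)%N -> (0 < n)%N ->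
  optimal_word A w -> opnorm N = opnorm (word_prod A w) ->
  set_products (range A) (2 * n)%N (N^T *m N) ->
  spectral_finiteness (range A) /\
  gen_spectral_radius (range A) = opnorm (word_prod A w) `^ n%:R^-1 /\
  opnorm (word_prod A w) `^ n%:R^-1 =
    spectral_radius (N^T *m N) `^ (2 * n)%N%:R^-1.
Proof.
move=> d0 n0 wP Nw NA.
have Nroot : opnorm (word_prod A w) `^ n%:R^-1 =
    spectral_radius (N^T *m N) `^ (2 * n)%N%:R^-1.
  rewrite spectral_radius_gram // Nw -powR_mulrn ?opnorm_ge0 // -powRrM.
  by rewrite natrM invfM mulrA mulfV ?mul1r ?pnatr_eq0.
have le_c m : (0 < m)%N -> ubound
    [set spectral_radius M `^ m%:R^-1 | M in set_products (range A) m]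
    (opnorm (word_prod A w) `^ n%:R^-1).
  by move=> m0 _ [M MA <-]; exact: spectral_radius_root_le.
have sup_le_c : ubound
    [set sup [set spectral_radius M `^ m%:R^-1 | M in set_products (range A) m] |
      m in [set m : nat | (1 <= m)%N]] (opnorm (word_prod A w) `^ n%:R^-1).
  (* For an empty level the inner [sup] is 0, still below the bound. *)
  by move=> _ [m /= m0 <-]; apply: nonneg_sup_le; [exact: powR_ge0|exact: le_c].
have n20 : (0 < 2 * n)%N by rewrite muln_gt0.
have genE : gen_spectral_radius (range A) = opnorm (word_prod A w) `^ n%:R^-1.
  apply/eqP; rewrite eq_le; apply/andP; split.
    by apply: nonneg_sup_le; first exact: powR_ge0.
  (* The Gram matrix lies in level 2n and attains the bound; [sup_le_c] and [le_c] now serve as the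
     boundedness that both suprema require. *)
  apply: le_trans (ub_le_sup (ex_intro _ _ sup_le_c) _); last by exists (2 * n)%N.
  rewrite Nroot; apply: (ub_le_sup (ex_intro _ _ (le_c _ n20))).
  by exists (N^T *m N).
split; last by split.
by exists (2 * n)%N; split => //; exists (N^T *m N); rewrite genE.
Qed.

Theorem theorem1 (R : realType) (K d : nat) (hK : (2 <= K)%N) (hd : (2 <= d)%N)
    (A : 'I_K -> 'M[R]_d) (n : nat) (hn : (1 <= n)%N) (w : n.-tuple 'I_K)
    (hw : optimal_word A w) :
  (set_products (range A) (2 * n)%N ((word_prod A w)^T *m word_prod A w) ->
     spectral_finiteness (range A) /\
     gen_spectral_radius (range A) = opnorm (word_prod A w) `^ n%:R^-1 /\
     opnorm (word_prod A w) `^ n%:R^-1 =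
       spectral_radius ((word_prod A w)^T *m word_prod A w)
         `^ (2 * n)%N%:R^-1) /\
  (set_products (range A) (2 * n)%N (word_prod A w *m (word_prod A w)^T) ->
     spectral_finiteness (range A) /\
     gen_spectral_radius (range A) = opnorm (word_prod A w) `^ n%:R^-1 /\
     opnorm (word_prod A w) `^ n%:R^-1 =
       spectral_radius (word_prod A w *m (word_prod A w)^T)
         `^ (2 * n)%N%:R^-1).
Proof.
have d0 : (0 < d)%N by exact: ltnW.
split; first exact: gram_spectral_finiteness.
(* With the transpose as [N], the Gram matrix is the product in the other order, and the norm is
   unchanged. *)
move=> NA; have := @gram_spectral_finiteness R K d A n w (word_prod A w)^T d0 hn hw.
by rewrite trmxK; apply; rewrite ?opnorm_trmx.
Qed.
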